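(* Let $\ell\ge0$. If a two-digit subdivision scheme preserves the space of algebraic polynomials of degree $\ell$, then it has at least $\ell+2$ (nonzero) coefficients.
   Context: A subdivision scheme is generated by an integer $n\times n$ matrix $M$ all of whose eigenvalues have modulus $>1$ and by real coefficients $\{c_k\}_{k\in\mathbb Z^n}$, finitely many nonzero, with $\sum_kc_k=m$, $m=|\det M|$. It is the recursive application of the subdivision operator $[Sa](j)=\sum_{k\in\mathbb Z^n}c_{j-Mk}\,a(k)$, $j\in\mathbb Z^n$, to sequences $a:\mathbb Z^n\to\mathbb R$. The scheme is two-digit if $|\det M|=2$. The scheme preserves the space of algebraic polynomials of degree $\ell$ if, whenever $a$ is the restriction to $\mathbb Z^n$ of an algebraic polynomial of degree at most $\ell$, so is $Sa$. *)

(* Defs.v *)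
From HB Require Import structures.
From mathcomp Require Import all_boot all_order all_algebra.
From mathcomp Require Import finmap complex.
From mathcomp Require Import boolp classical_sets functions cardinality fsbigop.
From mathcomp Require Import reals.
From mathcomp Require Import mpoly.

Set Implicit Arguments.
Unset Strict Implicit.
Unset Printing Implicit Defensive.

Import Order.TTheory GRing.Theory Num.Theory.

Local Open Scope classical_set_scope.
Local Open Scope ring_scope.

Definition expanding (R : realType) (n : nat) (M : 'M[int]_n) : Prop :=
  forall z : R[i],
    eigenvalue (map_mx (fun x : int => x%:~R : R[i]) M) z -> 1 < `|z|.

Definition two_digit (n : nat) (M : 'M[int]_n) : Prop := `|\det M|%N = 2%N.

Definition coeff_set (R : realType) (n : nat) (c : 'cV[int]_n -> R) :
    set 'cV[int]_n :=
  [set k | c k != 0].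

(* Pitfall: [\sum_(k \in A) F k] is 0 by convention if infinitely many [F k]
   are nonzero; finiteness of the mask rules this out here. *)
Record subdivision_scheme (R : realType) (n : nat)
    (M : 'M[int]_n) (c : 'cV[int]_n -> R) : Prop := SubdivisionScheme {
  scheme_expanding : expanding R M;
  scheme_finite : finite_set (coeff_set c);
  scheme_sum : \sum_(k \in [set: 'cV[int]_n]) c k = `|\det M|%N%:R
}.

(* An expanding [M] is injective, so for a finitely supported [c] the sum below
   has finitely many nonzero terms. *)
Definition subdivision_op (R : realType) (n : nat)
    (M : 'M[int]_n) (c a : 'cV[int]_n -> R) (j : 'cV[int]_n) : R :=
  \sum_(k \in [set: 'cV[int]_n]) c (j - M *m k) * a k.

(* [msize p] is the total degree of [p] plus one, and 0 if [p = 0]. *)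
Definition poly_seq (R : realType) (n l : nat) (a : 'cV[int]_n -> R) : Prop :=
  exists2 p : {mpoly R[n]}, (msize p <= l.+1)%N &
    forall k : 'cV[int]_n, a k = p.@[fun i => (k i 0)%:~R].

Definition preserves_polynomials (R : realType) (n : nat)
    (M : 'M[int]_n) (c : 'cV[int]_n -> R) (l : nat) : Prop :=
  forall a : 'cV[int]_n -> R, poly_seq l a -> poly_seq l (subdivision_op M c a).

(* Main.v *)
(** Since [|det M| = 2], the lattice [Z^n] is the union of [M Z^n], the kernel
    of a parity [phi mod 2], and a single other coset.  On each coset [Sa] is
    the restriction of the polynomial [sum_m c_m a(M^-1 (x - m))], with [m]
    ranging over that coset.  Since [Sa] is itself a polynomial, the two
    polynomials coincide; evaluating them at [x = 0] gives the sum rule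
    [sum_m (-1)^(phi m) c_m p(- M^-1 m) = 0] for every [p] of degree at most
    [l].  With at most [l + 1] nonzero coefficients, a product of at most [l]
    affine forms vanishes at all nodes [- M^-1 m] but one, contradicting the
    sum rule. *)

Require Import Defs.
From HB Require Import structures.
From mathcomp Require Import all_boot all_order all_algebra.
From mathcomp Require Import finmap complex.
From mathcomp Require Import boolp classical_sets functions cardinality fsbigop.
From mathcomp Require Import reals.
From mathcomp Require Import mpoly.
From mathcomp Require Import zify.

Set Implicit Arguments.
Unset Strict Implicit.
Unset Printing Implicit Defensive.

Import Order.TTheory GRing.Theory Num.Theory.

Local Open Scope classical_set_scope.
Local Open Scope ring_scope.

Lemma prodn_eq2 (I : finType) (f : I -> nat) :
  (\prod_i f i)%N = 2%N -> exists2 i0, f i0 = 2%N &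
    forall i, i != i0 -> f i = 1%N.
Proof.
move=> f2; have : (2 %| \prod_i f i)%N by rewrite f2.
rewrite Euclid_dvd_prod // big_has => /hasP[i0 _ even_i0].
move: f2; rewrite (bigD1 i0) //= => f2.
have rest1 : (\prod_(i | i != i0) f i = 1)%N.
  case/dvdnP: even_i0 f2 => q -> /eqP.
  by rewrite mulnAC (eqn_pmul2r (n2 := 1)) // muln_eq1 => /andP[_ /eqP].
exists i0 => [|i ne_i]; first by move: f2; rewrite rest1 muln1.
by apply/eqP; rewrite -dvdn1 -rest1 (bigD1 i) //= dvdn_mulr.
Qed.

(** In a Smith form [M = L D T], determinant of modulus 2 forces one diagonal entry of [D] to be 2
    up to sign and all others to be units. The corresponding row of [L^-1] is [phi], and the
    matching column of [L] is [w]. *)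
Lemma two_digit_parity (n : nat) (M : 'M[int]_n) : two_digit M ->
  exists (phi : 'rV[int]_n) (w : 'cV[int]_n), (phi *m w) 0 0 = 1 /\
    forall j : 'cV[int]_n,
      (exists k, j = M *m k) <-> (2%:Z %| ((phi *m j) 0 0)%R)%Z.
Proof.
case: (int_Smith_normal_form M) => L uL [T uT [d _ defM]].
set D := (\matrix_(i, j) _) in defM.
have Ddiag : D = diag_mx (\row_i d`_i) by apply/matrixP => i j; rewrite !mxE.
have absz_unit (x : int) : x \is a GRing.unit -> `|x|%N = 1%N.
  by case/orP => /eqP->.
rewrite /two_digit defM !det_mulmx !abszM.
move: (uL) (uT); rewrite !unitmxE => /absz_unit-> /absz_unit->.
rewrite mul1n muln1 Ddiag det_diag.
rewrite (big_morph absz abszM (erefl _)) => /prodn_eq2[i0 di0 di].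
exists (row i0 (invmx L)), (col i0 L).
split=> [|j].
  by rewrite -row_mul colE mulmxA mulVmx // mul1mx !mxE !eqxx.
rewrite -row_mul mxE -Ddiag; split=> [[k ->]|even_j].
  rewrite !mulmxA mulVmx // mul1mx -mulmxA Ddiag mul_diag_mx mxE.
  by apply: dvdz_mulr; rewrite dvdzE di0.
(* This is [T^-1 D^-1 L^-1 j]; the divisions are exact, because the only non-unit divisor, at [i0],
   meets the even entry [phi j]. *)
exists (invmx T *m \col_i (((invmx L *m j) i 0)%R %/ d`_i)%Z).
rewrite -mulmxA mulKVmx // -mulmxA Ddiag.
rewrite -[LHS](mulKVmx uL); congr (_ *m _).
apply/colP => i; rewrite mul_diag_mx !mxE mulrC divzK //.
move: (di i) di0; rewrite mxE dvdzE; case: (eqVneq i i0) => [->|_ -> //] _.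
by rewrite mxE => ->; move: even_j; rewrite mxE dvdzE.
Qed.

Lemma poly_eq_on_parity_class (R : numDomainType) (b : bool) (P Q : {poly R}) :
  (forall t : nat, odd t = b -> P.[t%:R] = Q.[t%:R]) -> P = Q.
Proof.
move=> eqPQ; apply/eqP; rewrite -subr_eq0; apply/eqP.
pose rs : seq R := [seq (t.*2 + b)%:R | t <- iota 0 (size (P - Q))].
apply: (@roots_geq_poly_eq0 _ _ rs); last by rewrite size_map size_iota.
  apply/allP => _ /mapP[t _ ->]; rewrite rootE hornerD hornerN subr_eq0.
  by rewrite eqPQ // oddD odd_double oddb.
rewrite map_inj_uniq ?iota_uniq // => s t /eqP.
by rewrite eqr_nat => /eqP; lia.
Qed.

(** Restriction to a line reduces the comparison of polynomials on cosets to one variable. *)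
Lemma meval_line (R : comNzRingType) (n : nat) (p : {mpoly R[n]})
    (v w : 'cV[R]_n) :
  exists P : {poly R}, forall t, P.[t] = p.@[fun i => (t *: w + v) i 0].
Proof.
exists (\sum_(m <- msupp p) p@_m *: \prod_i (w i 0 *: 'X + (v i 0)%:P) ^+ m i).
move=> t; rewrite mevalE horner_sum; apply: eq_bigr => m _.
rewrite hornerZ horner_prod; congr (_ * _); apply: eq_bigr => i _.
by rewrite horner_exp !hornerE !mxE mulrC.
Qed.

(** Multiply one affine form [X_i - y_i] for each [y] in [s], with [i] a coordinate in which [x] and
    [y] differ. *)
Lemma mpoly_separates (R : fieldType) (n : nat) (s : seq 'cV[R]_n)
    (x : 'cV[R]_n) : x \notin s ->
  exists p : {mpoly R[n]}, [/\ (msize p <= (size s).+1)%N,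
    forall y, y \in s -> p.@[fun i => y i 0] = 0 & p.@[fun i => x i 0] != 0].
Proof.
elim: s => [_|y s IHs]; first by exists 1; rewrite msize1 meval1 oner_eq0.
rewrite inE negb_or => /andP[ne_xy /IHs[p [sz_p p0 px]]].
have [i ne_xyi] : exists i, x i 0 != y i 0.
  by apply/existsP; apply: contraR ne_xy => /existsPn eq_xy;
     apply/eqP/colP => i; apply/eqP; rewrite -[_ == _]negbK eq_xy.
exists (('X_i - (y i 0)%:MP) * p); split=> [|z|].
- have nz_p : p != 0 by apply: contraNneq px => ->; rewrite meval0.
  have nz_q : 'X_i - (y i 0)%:MP != 0 :> {mpoly R[n]}.
    apply: contraNneq ne_xyi => /(congr1 (meval (fun i => x i 0))).
    by rewrite mevalB mevalXU mevalC meval0 => /eqP; rewrite subr_eq0.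
  have sz_q : (msize ('X_i - (y i 0)%:MP : {mpoly R[n]})%R <= 2)%N.
    apply: leq_trans (msizeD_le _ _) _.
    by rewrite msizeN msizeX mdeg1 msizeC geq_max; case: (_ == _).
  by rewrite msizeM // -subn1 leq_subLR; apply: leq_add sz_q sz_p.
- rewrite inE mevalM mevalB mevalXU mevalC => /predU1P[->|/p0 ->].
    by rewrite subrr mul0r.
  by rewrite mulr0.
- by rewrite mevalM mevalB mevalXU mevalC mulf_neq0 // subr_eq0.
Qed.

Section SumRule.
Variables (R : realType) (n : nat) (M : 'M[int]_n) (c : 'cV[int]_n -> R).
Hypotheses (detM : \det M != 0) (fin_c : finite_set (coeff_set c)).

Let toR (m p : nat) (A : 'M[int]_(m, p)) : 'M[R]_(m, p) := map_mx intr A.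
Let S := fset_set (coeff_set c).

Lemma toR_unit : toR M \in unitmx.
Proof. by rewrite unitmxE det_map_mx unitfE intr_eq0. Qed.

(** Substituting [m = j - M k], which is injective in [k], turns the sum over the lattice into one
    over the finite mask, with [k = M^-1 (j - m)] computed over the reals. *)
Lemma subdivision_opE (g : 'cV[R]_n -> R) j :
  subdivision_op M c (fun k => g (toR k)) j =
  \sum_(m <- S | `[< exists k, j - m = M *m k >])
     c m * g (invmx (toR M) *m toR (j - m)).
Proof.
pose G m := if `[< exists k, j - m = M *m k >]
  then c m * g (invmx (toR M) *m toR (j - m)) else 0.
rewrite big_mkcond -[RHS](@fsbigTE _ _ _ _ S G) => [|m]; last first.
  rewrite /G in_fset_set // notin_setE /coeff_set /= => /negP/negPn/eqP ->.
  by rewrite mul0r if_same.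
have inj_h : set_inj setT (fun k => j - M *m k).
  move=> k k' _ _ /addrI/oppr_inj/(congr1 (@toR _ _)).
  rewrite /toR !map_mxM => /(can_inj (mulKmx toR_unit)).
  by move=> /matrixP eqk; apply/matrixP => a b; have := eqk a b;
     rewrite !mxE => /intr_inj.
rewrite -(@fsbig_widen _ _ _ _ ((fun k => j - M *m k) @` setT) setT G) //.
  rewrite fsbig_image //; apply: eq_fsbigr => k _.
  rewrite /G asboolT; last by exists k; rewrite subKr.
  by rewrite subKr /toR map_mxM mulKmx // toR_unit.
move=> m [_ notin_m]; rewrite /= /G asboolF // => -[k jm].
by apply: notin_m; exists k => //; rewrite -jm subKr.
Qed.

Lemma sum_rule (l : nat) (phi : 'rV[int]_n) (w : 'cV[int]_n)
    (p : {mpoly R[n]}) :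
    (phi *m w) 0 0 = 1 ->
    (forall j : 'cV_n,
      (exists k, j = M *m k) <-> (2%:Z %| ((phi *m j) 0 0)%R)%Z) ->
    preserves_polynomials M c l -> (msize p <= l.+1)%N ->
  \sum_(m <- S | (2%:Z %| ((phi *m m) 0 0)%R)%Z)
     c m * p.@[fun i => (- (invmx (toR M) *m toR m)) i 0] =
  \sum_(m <- S | ~~ (2%:Z %| ((phi *m m) 0 0)%R)%Z)
     c m * p.@[fun i => (- (invmx (toR M) *m toR m)) i 0].
Proof.
move=> phiw rangeM presM sz_p.
pose g (x : 'cV[R]_n) := p.@[fun i => x i 0].
have [|q _ qE] := presM (fun k => g (toR k)).
  by exists p => // k; apply: meval_eq => i; rewrite mxE.
have [P PE] := meval_line q 0 (toR w).
have /choice[H HE] m :=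
  meval_line p (- (invmx (toR M) *m toR m)) (invmx (toR M) *m toR w).
(* [Q b] interpolates the subdivided sequence at those points [t w] of the
   line through [w] for which [t] has parity [b]. *)
pose Q (b : bool) :=
  \sum_(m <- S | (2%:Z %| ((phi *m m) 0 0)%R)%Z == ~~ b) c m *: H m.
have QP b : Q b = P.
  apply: (@poly_eq_on_parity_class _ b) => t odd_t.
  rewrite PE horner_sum.
  transitivity (subdivision_op M c (fun k => g (toR k)) (t%:Z *: w)).
    rewrite subdivision_opE; apply: eq_big => m.
      (* Since [phi w = 1], the point [t w - m] lies in [M Z^n] exactly when [phi m] and [t] have
         the same parity. *)
      rewrite (_ : `[< _ >] = (2%:Z %| ((phi *m (t%:Z *: w - m)) 0 0)%R)%Z).
        rewrite mulmxBr -scalemxAr; move: (phi *m m) (phi *m w) phiw => A B.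
        by rewrite !mxE -odd_t => ->; move: (A 0 0) => a; lia.
      by apply/asboolP/idP => /rangeM.
    move=> _; rewrite hornerZ HE /g; congr (_ * _); apply: meval_eq => i.
    by rewrite /toR map_mxB map_mxZ mulmxBr -scalemxAr.
  rewrite qE; apply: meval_eq => i; rewrite addr0 !mxE.
  by rewrite intrM.
have QE b : (Q b).[0] = \sum_(m <- S | (2%:Z %| ((phi *m m) 0 0)%R)%Z == ~~ b)
    c m * p.@[fun i => (- (invmx (toR M) *m toR m)) i 0].
  rewrite horner_sum; apply: eq_bigr => m _; rewrite hornerZ HE.
  by congr (_ * _); apply: meval_eq => i; rewrite scale0r add0r.
transitivity (Q false).[0].
  by rewrite QE; apply: eq_bigl => m; rewrite eqb_id.
by rewrite QP -(QP true) QE; apply: eq_bigl => m; rewrite eqbF_neg.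
Qed.

End SumRule.

Theorem theorem9p1 (R : realType) (n : nat) (M : 'M[int]_n)
    (c : 'cV[int]_n -> R) (l : nat)
    (scheme_Mc : subdivision_scheme M c)
    (two_digit_M : two_digit M)
    (preserves_l : preserves_polynomials M c l) :
  (l + 2 <= #|` fset_set (coeff_set c)|)%N.
Proof.
case: scheme_Mc => _ fin_c sum_c.
have detM : \det M != 0 by rewrite -absz_eq0 two_digit_M.
have [phi [w [phiw rangeM]]] := two_digit_parity two_digit_M.
set S := fset_set _.
(* An empty mask would sum to 0 instead of 2. *)
have [m0 m0S] : exists m0, m0 \in S.
  apply/fset0Pn; apply/eqP => S0; move: sum_c.
  rewrite (@fsbigTE _ _ _ _ S) => [|m]; last first.
    by rewrite in_fset_set // notin_setE /coeff_set /= => /negP/negPn/eqP.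
  by rewrite S0 big_nil two_digit_M => /esym/eqP; rewrite pnatr_eq0.
rewrite leqNgt; apply/negP => ltS.
pose y (m : 'cV[int]_n) := - (invmx (map_mx intr M : 'M[R]_n) *m map_mx intr m).
have inj_y : injective y.
  move=> m m' /oppr_inj/(can_inj (mulKVmx (toR_unit R detM)))/matrixP eqm.
  by apply/matrixP => a b; have := eqm a b; rewrite !mxE => /intr_inj.
(* Dropping [m0] leaves at most [l] nodes, so the degree of [p] is at most [l]. *)
have [|p [sz_p p0 pm0]] := @mpoly_separates
    _ _ [seq y m | m <- rem m0 S] (y m0).
  by rewrite mem_map // mem_rem_uniqF // fset_uniq.
have sz_pl : (msize p <= l.+1)%N.
  apply: leq_trans sz_p _; rewrite size_map size_rem //.
  by rewrite ltnS -subn1 leq_subLR add1n -ltnS -addn2.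
have := sum_rule detM fin_c phiw rangeM preserves_l sz_pl.
have vanish m : m \in S -> m != m0 -> c m * p.@[fun i => y m i 0] = 0.
  move=> mS ne_m; rewrite p0 ?mulr0 // mem_map //.
  by rewrite mem_rem_uniq ?fset_uniq // !inE ne_m.
(* Only the term of [m0] survives, and [m0] has just one parity: one side of the sum rule is this
   nonzero term and the other is 0. *)
have sumE (A : pred 'cV[int]_n) :
    \sum_(m <- S | A m) c m * p.@[fun i => y m i 0] =
    if A m0 then c m0 * p.@[fun i => y m0 i 0] else 0.
  rewrite big_mkcond (bigD1_seq m0) ?fset_uniq //= big1_seq ?addr0 // => m.
  by case/andP => ne_m mS; case: ifP => // _; exact: vanish.
have nz : c m0 * p.@[fun i => y m0 i 0] != 0.
  by rewrite mulf_neq0 //; move: m0S; rewrite in_fset_set // inE.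
by rewrite !sumE; case: ifP => _ /= e; move: nz;
  [rewrite e eqxx | rewrite -e eqxx].
Qed.
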